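(* Let $\mathbf{A} = \mathbf{B} + \mathbf{E}$ with $\mathbf{A}, \mathbf{B}, \mathbf{E} \in \mathrm{H}^{m \times n}$ and $\mathbf{B} \neq 0$, and let $I \subseteq [m]$, $J \subseteq [n]$. Let $\mathbf{B} = \mathbf{U} \Sigma V^*$ and $\mathbf{B}^\intercal = \mathbf{P} \Lambda Q^*$ be SVDs. Denote $\mathbf{G} = \mathbf{A}(I,J)$ and $$\eta_r = \|\mathbf{U}(I,:)^\dagger\|_{\ell_2(\mathrm{H}) \to \ell_2}, \quad \eta_c = \|(V(J,:)^* )^\dagger\|_{\ell_2 \to \ell_2}, \quad \xi_r = \|Q(I,:)^\dagger\|_{\ell_2 \to \ell_2}, \quad \xi_c = \|\mathbf{P}(J,:)^\dagger\|_{\ell_2(\mathrm{H}) \to \ell_2},$$ $$\tilde{\eta} = \eta_r + \eta_c + 3 \eta_r \eta_c, \qquad \tilde{\xi} = \xi_c + \xi_r + 3 \xi_c \xi_r.$$ Assume $\mathrm{rank}_{\mathrm{T}}(\mathbf{B}(I,J)) = \mathrm{rank}_{\mathrm{T}}(\mathbf{B})$. Then $$\begin{aligned} \|\mathbf{B} - \mathrm{cross}(\mathbf{A}, I, J)\|_{\ell_2(\mathrm{H})} &\leq \tilde{\eta} (2 + \tilde{\xi}) \|\mathbf{E}\|_{\ell_2(\mathrm{H})} \\ &\quad + (1 + \tilde{\eta})(2 + \tilde{\xi}) \Big( \|\mathbf{G}^\dagger\|_{\ell_2(\mathrm{H}) \to \ell_2} + \|(\mathbf{G}^\intercal)^\dagger\|_{\ell_2(\mathrm{H})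 \to \ell_2} \Big) \|\mathbf{E}\|_{\ell_2(\mathrm{H})}^2. \end{aligned}$$
   Context: Let $\mathbb{F} \in \{\mathbb{R}, \mathbb{C}\}$ and let $\mathrm{H}$ be a Hilbert space over $\mathbb{F}$ with inner product linear in the second argument. A Bochner matrix $\mathbf{A} \in \mathrm{H}^{m \times n}$ is an $m \times n$ array with entries in $\mathrm{H}$; classical matrices have entries in $\mathbb{F}$. Transposition $^\intercal$ only rearranges entries (no conjugation); Bochner matrices may be multiplied by classical matrices on either side by the usual rule. $[n] = \{1,\ldots,n\}$; $\mathbf{A}(I,J)$ is the submatrix with rows $I$ and columns $J$, and '':'' means all indices. $\mathrm{H}^m$ is a Hilbert space with inner product $\sum_i \langle x_i, y_i\rangle_{\mathrm{H}}$; $\|\mathbf{A}\|_{\ell_2(\mathrm{H})} = (\sum_{i,j} \|\mathbf{A}(i,j)\|_{\mathrm{H}}^2)^{1/2}$; $\mathbb{F}^n$ has the Euclidean norm. A Bochner matrix $\mathbf{A}$ is identified with the bounded finite-rank operator $\mathbb{F}^n \to \mathrm{H}^m$, $x \mapsto \mathbf{A}x$; $\mathrm{rank}(\mathbf{A})$ is its rank; $\mathbf{A}^*:\mathrm{H}^m \to \mathbb{F}^n$ is its adjoint and $\mathbf{A}^\dagger : \mathrm{H}^m \to \mathbb{F}^n$ its Moore--Penrose pseudoinverse; such operators are applied to Bochner matrices columnwise, giving classical matrices. $\mathrm{rank}_{\mathrm{c}}(\mathbf{A}) = \mathrm{rank}(\mathbf{A})$, $\mathrm{rank}_{\mathrm{r}}(\mathbf{A})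 = \mathrm{rank}(\mathbf{A}^\intercal)$, $\mathrm{rank}_{\mathrm{T}}(\mathbf{A}) = (\mathrm{rank}_{\mathrm{r}}(\mathbf{A}), \mathrm{rank}_{\mathrm{c}}(\mathbf{A}))$. An SVD of a nonzero $\mathbf{B}\in \mathrm{H}^{m\times n}$ with $r=\mathrm{rank}(\mathbf{B})$ is $\mathbf{B} = \mathbf{U}\Sigma V^*$ with $\mathbf{U} \in \mathrm{H}^{m \times r}$, $\mathbf{U}^*\mathbf{U} = \mathsf{I}_r$, $V \in \mathbb{F}^{n \times r}$, $V^*V = \mathsf{I}_r$, $\Sigma = \mathrm{diag}(\sigma_1,\ldots,\sigma_r)$, $\sigma_1 \ge \cdots \ge \sigma_r > 0$. The cross approximation is $$\mathrm{cross}(\mathbf{A}, I, J) = ((\mathbf{G}^\intercal)^\dagger \mathbf{C}^\intercal)^\intercal\, \mathbf{G}\, (\mathbf{G}^\dagger \mathbf{R}), \quad \mathbf{C} = \mathbf{A}(:,J),\ \mathbf{R} = \mathbf{A}(I,:),\ \mathbf{G} = \mathbf{A}(I,J).$$ Subscripts such as $\|\cdot\|_{\ell_2(\mathrm{H}) \to \ell_2}$ denote operator norms. *)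

(* Defs.v *)
From HB Require Import structures.
From mathcomp Require Import all_boot all_order all_algebra.
From mathcomp Require Import complex.
From mathcomp Require Import all_classical all_reals all_analysis.

Set Implicit Arguments.
Unset Strict Implicit.
Unset Printing Implicit Defensive.

Import Order.TTheory GRing.Theory Num.Theory.
Import numFieldNormedType.Exports.

Local Open Scope classical_set_scope.
Local Open Scope ring_scope.

Variant RorC_kind := RealScalars | ComplexScalars.

Definition RorC (R : realType) (k : RorC_kind) : numFieldType :=
  match k with
  | RealScalars => R
  | ComplexScalars => R[i]
  end.

Definition conjF (R : realType) (k : RorC_kind) :
    {rmorphism RorC R k -> RorC R k} :=
  match k with
  | RealScalars => idfun
  | ComplexScalars => @conjc R
  end.

Definition reF (R : realType) (k : RorC_kind) : RorC R k -> R :=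
  match k with
  | RealScalars => idfun
  | ComplexScalars => @complex.Re R
  end.

HB.mixin Record CompleteNormedModule_isHilbert (R : realType) (k : RorC_kind)
    H of CompleteNormedModule (RorC R k) H := {
  inner : H -> H -> RorC R k ;
  inner_linearr : forall (x : H) (a : RorC R k) (y z : H),
    inner x (a *: y + z) = a * inner x y + inner x z ;
  innerC : forall x y : H, inner x y = conjF R k (inner y x) ;
  inner_norm : forall x : H, inner x x = `|x| ^+ 2
}.

#[short(type="hilbertType")]
HB.structure Definition Hilbert (R : realType) (k : RorC_kind) :=
  {H of CompleteNormedModule_isHilbert R k H &
        CompleteNormedModule (RorC R k) H}.

Section Pseudoinverse.
Variables (F : Type) (X Y : Type) (dotX : X -> X -> F) (dotY : Y -> Y -> F).

(* The Penrose equations for f, where the two projections are selfadjoint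
   for the given inner products.  When f is linear and dotX, dotY are
   definite, they have at most one solution, and it is linear. *)
Definition is_pinv (f : X -> Y) (g : Y -> X) : Prop :=
  [/\ forall x, f (g (f x)) = f x,
      forall y, g (f (g y)) = g y,
      forall y y', dotY (f (g y)) y' = dotY y (f (g y')) &
      forall x x', dotX (g (f x)) x' = dotX x (g (f x'))].

End Pseudoinverse.

Definition pinv (F : Type) (X : choiceType) (Y : Type) (x0 : X)
    (dotX : X -> X -> F) (dotY : Y -> Y -> F) (f : X -> Y) : Y -> X :=
  xget (fun=> x0) [set g | is_pinv dotX dotY f g].

Definition opnorm (R : realType) (X Y : Type) (normX : X -> R) (normY : Y -> R)
    (f : X -> Y) : R :=
  sup [set normY (f x) | x in [set x | normX x <= 1]].

Section Submatrices.
Variables (T : Type) (m n : nat).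

Definition submatrix (A : 'M[T]_(m, n)) (I : {set 'I_m}) (J : {set 'I_n}) :
    'M[T]_(#|I|, #|J|) :=
  mxsub (@enum_val _ (mem I)) (@enum_val _ (mem J)) A.

Definition subrows (A : 'M[T]_(m, n)) (I : {set 'I_m}) : 'M[T]_(#|I|, n) :=
  rowsub (@enum_val _ (mem I)) A.

Definition subcols (A : 'M[T]_(m, n)) (J : {set 'I_n}) : 'M[T]_(m, #|J|) :=
  colsub (@enum_val _ (mem J)) A.

End Submatrices.

(* A Bochner matrix is an 'M[H]_(m, n), acting as x |-> mulHF A x from 'cV[F]_n
   to 'cV[H]_m.  The prefix h is for operations on Bochner matrices, the prefix
   e for the Euclidean ones on matrices over F. *)
Section Bochner.
Variables (R : realType) (k : RorC_kind).
Local Notation F := (RorC R k).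

Definition ctmx m n (M : 'M[F]_(m, n)) : 'M[F]_(n, m) := map_mx (conjF R k) M^T.

Definition edot n (x y : 'cV[F]_n) : F := \sum_i conjF R k (x i 0) * y i 0.

Definition enorm n (x : 'cV[F]_n) : R := Num.sqrt (\sum_i reF `|x i 0| ^+ 2).

Variable H : hilbertType R k.

Definition mulHF m n p (A : 'M[H]_(m, n)) (M : 'M[F]_(n, p)) : 'M[H]_(m, p) :=
  \matrix_(i, l) \sum_j M j l *: A i j.

Definition mulFH m n p (M : 'M[F]_(m, n)) (A : 'M[H]_(n, p)) : 'M[H]_(m, p) :=
  \matrix_(i, l) \sum_j M i j *: A j l.

Definition hdot m (x y : 'cV[H]_m) : F := \sum_i inner (x i 0) (y i 0).

(* For n = 1 this is also the norm of the Hilbert space H^m. *)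
Definition hnorm m n (A : 'M[H]_(m, n)) : R :=
  Num.sqrt (\sum_i \sum_j reF `|A i j| ^+ 2).

Definition hadj m n (A : 'M[H]_(m, n)) (y : 'cV[H]_m) : 'cV[F]_n :=
  \col_j \sum_i inner (A i j) (y i 0).

Definition columnwise p q n (f : 'cV[H]_p -> 'cV[F]_q) (A : 'M[H]_(p, n)) :
    'M[F]_(q, n) :=
  \matrix_(i, j) f (col j A) i 0.

Definition hpinv m n (A : 'M[H]_(m, n)) : 'cV[H]_m -> 'cV[F]_n :=
  pinv 0 (@edot n) (@hdot m) (mulHF A).

Definition epinv m n (M : 'M[F]_(m, n)) : 'cV[F]_m -> 'cV[F]_n :=
  pinv 0 (@edot n) (@edot m) (mulmx M).

Definition hopnorm m n (f : 'cV[H]_m -> 'cV[F]_n) : R :=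
  opnorm (@hnorm m 1) (@enorm n) f.

Definition eopnorm m n (f : 'cV[F]_m -> 'cV[F]_n) : R :=
  opnorm (@enorm m) (@enorm n) f.

(* The columns of b are a basis of the range of A in H^m. *)
Definition is_range_basis m n r (A : 'M[H]_(m, n)) (b : 'M[H]_(m, r)) : Prop :=
  injective (fun x : 'cV[F]_r => mulHF b x) /\
  range (fun x : 'cV[F]_r => mulHF b x) = range (fun x : 'cV[F]_n => mulHF A x).

Definition hrank m n (A : 'M[H]_(m, n)) : nat :=
  xget 0%N [set r | exists b : 'M[H]_(m, r), is_range_basis A b].

Definition rankT m n (A : 'M[H]_(m, n)) : nat * nat := (hrank A^T, hrank A).

(* The entries of sigma are compared in the order of F, for which 0 < s holds
   only if s is real. *)
Definition is_svd m n r (B : 'M[H]_(m, n))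
    (U : 'M[H]_(m, r)) (sigma : 'rV[F]_r) (V : 'M[F]_(n, r)) : Prop :=
  [/\ r = hrank B,
      columnwise (hadj U) U = 1%:M /\ ctmx V *m V = 1%:M,
      forall i, 0 < sigma 0 i,
      forall i j : 'I_r, (i <= j)%N -> sigma 0 j <= sigma 0 i &
      B = mulHF (mulHF U (diag_mx sigma)) (ctmx V)].

Definition cross_approx m n (A : 'M[H]_(m, n)) (I : {set 'I_m})
    (J : {set 'I_n}) : 'M[H]_(m, n) :=
  let C := subcols A J in
  let D := subrows A I in
  let G := submatrix A I J in
  mulHF (mulFH (columnwise (hpinv G^T) C^T)^T G) (columnwise (hpinv G) D).

Lemma hadjP m n (A : 'M[H]_(m, n)) (x : 'cV[F]_n) (y : 'cV[H]_m) :
  hdot (mulHF A x) y = edot x (hadj A y).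
Proof.
have innerDl (u v w : H) : inner (u + v) w = inner u w + inner v w.
  rewrite innerC -[u]scale1r inner_linearr mul1r scale1r rmorphD /=.
  by rewrite -!innerC.
have inner0r (w : H) : inner w (0 : H) = 0.
  have := inner_linearr w (-1) 0 0.
  by rewrite scaler0 addr0 mulN1r addNr.
have innerZl a (u w : H) : inner (a *: u) w = conjF R k a * inner u w.
  rewrite innerC -[a *: u]addr0 inner_linearr inner0r addr0 rmorphM.
  by rewrite -innerC.
have inner0l (w : H) : inner (0 : H) w = 0 by rewrite innerC inner0r rmorph0.
rewrite /hdot /edot.
transitivity (\sum_i \sum_j conjF R k (x j 0) * inner (A i j) (y i 0)).
  apply: eq_bigr => i _; rewrite mxE.
  rewrite (big_morph (inner^~ (y i 0)) (fun u v => innerDl u v _) (inner0l _)).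
  by apply: eq_bigr => j _; rewrite innerZl.
rewrite exchange_big; apply: eq_bigr => j _.
by rewrite mxE mulr_sumr.
Qed.

End Bochner.

(* Main.v *)
(* With C = A(:,J), R = A(I,:), Z = G^+ R and X the left factor of the cross
   approximation, B - X G Z = (B - C Z) + (C - X G) Z.  The rank hypothesis
   makes L = U U(I,:)^+ and W = (V(J,:)^* )^+ V^* satisfy L B(I,:) = B and
   B(:,J) W = B.  Hence R = G W + D with D = E(I,:) - E(I,J) W, and
     Z = G^+ G W + G^+ D,
     B - C Z = - L (G G^+ E(I,:) + (1 - G G^+) E(I,J) W)
               - (E(:,J) - L E(I,J)) Z.
   The first-order terms contain only projections, so the factor ||G^+|| appears
   only with ||E||^2.  Applied to the transposes, the first splitting expresses
   C - X G as the part of a perturbation of norm at most (1 + xi_r) ||E|| that a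
   projection removes; no third-order term arises.  Gram--Schmidt in H^m writes
   a Bochner matrix as Q X with Q^* Q = 1 and X classical and right invertible,
   which yields its pseudoinverse X^+ Q^* and reduces ||A N|| <= ||A|| ||N|| to
   the classical case. *)
Require Import Defs.
From mathcomp Require Import all_boot all_order all_algebra.
From mathcomp Require Import complex.
From mathcomp Require Import all_classical all_reals all_analysis.
From mathcomp Require Import ring lra.

Set Implicit Arguments.
Unset Strict Implicit.
Unset Printing Implicit Defensive.

Import Order.TTheory GRing.Theory Num.Theory.
Import numFieldNormedType.Exports.

Local Open Scope ring_scope.

(** * Cauchy--Schwarz and Minkowski for finite real sums *)

Section RealSums.
Variables (R : realType) (T : finType).
Implicit Types a b : T -> R.

Lemma sumsq_ge0 a : 0 <= \sum_i a i ^+ 2.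
Proof. by apply: sumr_ge0 => i _; rewrite sqr_ge0. Qed.

(** The sum of the squares [(t * a i - s * b i) ^+ 2] equals [t * (t * p - s ^+ 2)]; dividing by [t]
    gives the claim, and [t = 0] forces [b = 0]. *)
Lemma real_cauchy_schwarz a b :
  \sum_i a i * b i <= Num.sqrt (\sum_i a i ^+ 2) * Num.sqrt (\sum_i b i ^+ 2).
Proof.
set s := \sum_i a i * b i; set p := \sum_i a i ^+ 2.
set t := \sum_i b i ^+ 2.
have key : 0 <= t * (t * p - s ^+ 2).
  have -> : t * (t * p - s ^+ 2) = \sum_i (t * a i - s * b i) ^+ 2.
    transitivity (t ^+ 2 * p - (2 * t * s) * s + s ^+ 2 * t); first by ring.
    rewrite {2}/s /p {3}/t 3!mulr_sumr -sumrB -big_split /=.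
    by apply: eq_bigr => i _; ring.
  exact: sumsq_ge0.
have [t0|t_gt0] := eqVneq t 0.
  have b0 i : b i = 0.
    have /psumr_eq0P := t0 => /(_ (fun i _ => sqr_ge0 (b i))) /(_ i isT).
    by move/eqP; rewrite sqrf_eq0 => /eqP.
  rewrite t0 sqrtr0 mulr0 /s big1 // => i _; by rewrite b0 mulr0.
rewrite -sqrtrM ?sumsq_ge0 //; apply: le_trans (ler_norm _) _.
rewrite -sqrtr_sqr ler_wsqrtr // mulrC -subr_ge0.
by move: key; rewrite pmulr_rge0 // lt_neqAle eq_sym t_gt0 sumsq_ge0.
Qed.

Lemma real_minkowski a b : 
  Num.sqrt (\sum_i (a i + b i) ^+ 2) <=
  Num.sqrt (\sum_i a i ^+ 2) + Num.sqrt (\sum_i b i ^+ 2).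
Proof.
rewrite -[leRHS]ger0_norm ?addr_ge0 ?sqrtr_ge0 // -sqrtr_sqr ler_wsqrtr //.
rewrite sqrrD !sqr_sqrtr ?sumsq_ge0 //.
have -> : \sum_i (a i + b i) ^+ 2 =
    \sum_i a i ^+ 2 + (\sum_i a i * b i) *+ 2 + \sum_i b i ^+ 2.
  rewrite -sumrMnl -!big_split /=; apply: eq_bigr => i _; ring.
by rewrite lerD2r lerD2l lerMn2r real_cauchy_schwarz.
Qed.

End RealSums.

(** * Real and complex scalars treated uniformly *)

Definition ofR (R : realType) (k : RorC_kind) : {rmorphism R -> RorC R k} :=
  match k with
  | RealScalars => idfun
  | ComplexScalars => @real_complex R
  end.

Section Scalars.
Variables (R : realType) (k : RorC_kind).
Local Notation F := (RorC R k).
Local Notation ofR := (ofR R k).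

Lemma ofR_reF (x : F) : 0 <= x -> ofR (reF x) = x.
Proof.
case: k x => //= -[a b]; rewrite lecE /= => /andP[/eqP b0 _].
by rewrite /real_complex_def -b0.
Qed.

Lemma ler_ofR : {mono ofR : x y / x <= y}.
Proof. by case: k => //= x y; rewrite lecR. Qed.

Lemma ofR_inj : injective ofR.
Proof. exact: fmorph_inj. Qed.

Lemma conjFK : involutive (conjF R k).
Proof. case: k => //= x; exact: conjcK. Qed.

Lemma conjF_ofR x : conjF R k (ofR x) = ofR x.
Proof. case: k => //=; exact: conjc_real. Qed.

Lemma mul_conjF (x : F) : conjF R k x * x = `|x| ^+ 2.
Proof.
case: k x => /= x; first by rewrite real_normK ?num_real.
by rewrite mulrC -normCK.
Qed.

Lemma norm_ofR x : 0 <= x -> `|ofR x| = ofR x.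
Proof. by move=> x0; rewrite ger0_norm // -(rmorph0 ofR) ler_ofR. Qed.

Lemma norm_conjF (x : F) : `|conjF R k x| = `|x|.
Proof.
by apply/eqP; rewrite -(eqrXn2 (n := 2)) // -!mul_conjF conjFK mulrC.
Qed.

(** The norm of [V] takes its values in [F]. Since it is nonnegative there, [reF] loses nothing, and
    [ofR] carries inequalities between [R] and [F]. *)
Definition rnorm (V : normedModType F) (x : V) : R := reF `|x|.

Lemma ofR_rnorm (V : normedModType F) (x : V) : ofR (rnorm x) = `|x|.
Proof. exact: ofR_reF. Qed.

Lemma rnorm_ge0 (V : normedModType F) (x : V) : 0 <= rnorm x.
Proof. by rewrite -ler_ofR ofR_rnorm rmorph0. Qed.

Lemma ler_rnormD (V : normedModType F) (x y : V) :
  rnorm (x + y) <= rnorm x + rnorm y.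
Proof. by rewrite -ler_ofR rmorphD !ofR_rnorm ler_normD. Qed.

Lemma rnormZ (V : normedModType F) (a : F) (x : V) :
  rnorm (a *: x) = rnorm (a : F^o) * rnorm x.
Proof. by apply: (@ofR_inj); rewrite rmorphM !ofR_rnorm normrZ. Qed.

Lemma rnormM (a b : F) :
  rnorm (a * b : F^o) = rnorm (a : F^o) * rnorm (b : F^o).
Proof. by apply: (@ofR_inj); rewrite rmorphM !ofR_rnorm normrM. Qed.

Lemma rnormN (V : normedModType F) (x : V) : rnorm (- x) = rnorm x.
Proof. by rewrite /rnorm normrN. Qed.

Lemma rnorm_conjF (a : F) : rnorm (conjF R k a : F^o) = rnorm (a : F^o).
Proof. by apply: (@ofR_inj); rewrite !ofR_rnorm; exact: norm_conjF. Qed.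

Lemma rnorm_ofR (x : R) : 0 <= x -> rnorm (ofR x : F^o) = x.
Proof. by move=> x0; apply: ofR_inj; rewrite ofR_rnorm; exact: norm_ofR. Qed.

End Scalars.

(** * Frobenius norms over a normed module, covering both [H] and [F] *)

Section Frobenius.
Variables (R : realType) (k : RorC_kind) (V : normedModType (RorC R k)).

Definition frob m n (A : 'M[V]_(m, n)) : R :=
  Num.sqrt (\sum_i \sum_j rnorm (A i j) ^+ 2).

Lemma frob_ge0 m n (A : 'M[V]_(m, n)) : 0 <= frob A.
Proof. exact: sqrtr_ge0. Qed.

Lemma frob_sqr m n (A : 'M[V]_(m, n)) :
  frob A ^+ 2 = \sum_i \sum_j rnorm (A i j) ^+ 2.
Proof. by rewrite sqr_sqrtr //; apply: sumr_ge0 => i _; apply: sumsq_ge0. Qed.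

Lemma frob0_eq0 m n (A : 'M[V]_(m, n)) : frob A = 0 -> A = 0.
Proof.
move=> A0; have := frob_sqr A; rewrite A0 expr0n /= => /esym.
move/psumr_eq0P => /(_ (fun i _ => sumsq_ge0 (fun j => rnorm (A i j)))) h.
apply/matrixP => i j; rewrite !mxE.
have /psumr_eq0P := h i isT => /(_ (fun j _ => sqr_ge0 _)) /(_ j isT) /eqP.
rewrite sqrf_eq0 => /eqP /(congr1 (ofR R k)).
by rewrite ofR_rnorm rmorph0 => /eqP; rewrite normr_eq0 => /eqP.
Qed.

Lemma ler_frobD m n (A B : 'M[V]_(m, n)) : frob (A + B) <= frob A + frob B.
Proof.
rewrite /frob !pair_bigA /=.
apply: le_trans (real_minkowski (T := ('I_m * 'I_n)%type)
    (fun p => rnorm (A p.1 p.2)) (fun p => rnorm (B p.1 p.2))).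
apply: ler_wsqrtr; apply: ler_sum => p _; rewrite mxE.
by rewrite ler_sqr ?nnegrE ?addr_ge0 ?rnorm_ge0 // ler_rnormD.
Qed.

Lemma frobN m n (A : 'M[V]_(m, n)) : frob (- A) = frob A.
Proof.
by congr Num.sqrt; do 2!apply: eq_bigr => ? _; rewrite mxE rnormN.
Qed.

Lemma ler_frobB m n (A B : 'M[V]_(m, n)) : frob (A - B) <= frob A + frob B.
Proof. by rewrite -(frobN B) ler_frobD. Qed.

Lemma frob_tr m n (A : 'M[V]_(m, n)) : frob A^T = frob A.
Proof.
rewrite /frob exchange_big; congr Num.sqrt.
by do 2!apply: eq_bigr => ? _; rewrite mxE.
Qed.

Lemma frob_sqr_col m n (A : 'M[V]_(m, n)) :
  frob A ^+ 2 = \sum_j frob (col j A) ^+ 2.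
Proof.
rewrite frob_sqr exchange_big; apply: eq_bigr => j _.
by rewrite frob_sqr; apply: eq_bigr => i _; rewrite big_ord1 mxE.
Qed.

Lemma frob_subrows m n (A : 'M[V]_(m, n)) (I : {set 'I_m}) :
  frob (subrows A I) <= frob A.
Proof.
apply: ler_wsqrtr.
rewrite [leRHS](bigID (mem I)) /= -[leLHS]addr0; apply: lerD; last first.
  by apply: sumr_ge0 => i _; apply: sumsq_ge0.
rewrite [leRHS]big_enum_val /=; apply: ler_sum => i _.
by under eq_bigr do rewrite mxE.
Qed.

Lemma frob_subcols m n (A : 'M[V]_(m, n)) (J : {set 'I_n}) :
  frob (subcols A J) <= frob A.
Proof.
have -> : subcols A J = (subrows A^T J)^T by apply/matrixP => i j; rewrite !mxE.
by rewrite frob_tr -(frob_tr A) frob_subrows.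
Qed.

End Frobenius.

(** Squared norms add over columns, so a bound on vectors passes to matrices with the same constant.
    The entries may lie in different spaces, as for operators from [H^m] to [F^n]. *)
Lemma frob_le_cols (R : realType) (k : RorC_kind)
    (V W : normedModType (RorC R k)) m p n (A : 'M[V]_(m, n))
    (B : 'M[W]_(p, n)) (c : R) :
  0 <= c -> (forall j, frob (col j A) <= c * frob (col j B)) ->
  frob A <= c * frob B.
Proof.
move=> c0 h; rewrite -ler_sqr ?nnegrE ?mulr_ge0 ?frob_ge0 //.
rewrite exprMn !frob_sqr_col mulr_sumr; apply: ler_sum => j _.
by rewrite -exprMn ler_sqr ?nnegrE ?mulr_ge0 ?frob_ge0.
Qed.

(** * Classical matrices: adjoints and operator bounds *)

Section Euclidean.
Variables (R : realType) (k : RorC_kind).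
Local Notation F := (RorC R k).

Definition fnorm m n (M : 'M[F]_(m, n)) : R := @frob R k F^o m n M.

Lemma enorm_fnorm n (x : 'cV[F]_n) : enorm x = fnorm x.
Proof. by congr Num.sqrt; apply: eq_bigr => i _; rewrite big_ord1. Qed.

Lemma ctmxK m n : cancel (@ctmx R k m n) (@ctmx R k n m).
Proof. by move=> M; apply/matrixP => i j; rewrite !mxE conjFK. Qed.

Lemma ctmxM m n p (M : 'M[F]_(m, n)) (N : 'M[F]_(n, p)) :
  ctmx (M *m N) = ctmx N *m ctmx M.
Proof. by rewrite /ctmx trmx_mul map_mxM. Qed.

Lemma ctmx1 n : ctmx (1%:M : 'M[F]_n) = 1%:M.
Proof. by rewrite /ctmx trmx1 map_mx1. Qed.

Lemma fnorm_ctmx m n (M : 'M[F]_(m, n)) : fnorm (ctmx M) = fnorm M.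
Proof.
rewrite /fnorm -[RHS]frob_tr; congr Num.sqrt.
by do 2!apply: eq_bigr => ? _; rewrite !mxE rnorm_conjF.
Qed.

Lemma edotE n (x y : 'cV[F]_n) : edot x y = (ctmx x *m y) 0 0.
Proof. by rewrite mxE; apply: eq_bigr => i _; rewrite !mxE. Qed.

Lemma edot_norm n (x : 'cV[F]_n) : edot x x = ofR R k (fnorm x ^+ 2).
Proof.
rewrite frob_sqr rmorph_sum; apply: eq_bigr => i _.
by rewrite big_ord1 rmorphXn /= mul_conjF (ofR_rnorm (x i 0 : F^o)).
Qed.

Lemma ler_edot n (x y : 'cV[F]_n) :
  rnorm (edot x y : F^o) <= fnorm x * fnorm y.
Proof.
rewrite -!enorm_fnorm.
apply: le_trans (real_cauchy_schwarz (fun i => rnorm (x i 0 : F^o))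
  (fun i => rnorm (y i 0 : F^o))).
rewrite -(ler_ofR k) ofR_rnorm rmorph_sum.
apply: le_trans (ler_norm_sum _ _ _) _.
apply: ler_sum => i _.
by rewrite rmorphM !ofR_rnorm normrM norm_conjF.
Qed.

(** An upper bound for the operator norm, stated without a supremum. The sign condition does not
    follow from the inequality when [n = 0]. *)
Definition opbound m n (M : 'M[F]_(m, n)) (c : R) :=
  0 <= c /\ forall x : 'cV[F]_n, fnorm (M *m x) <= c * fnorm x.

Lemma opbound_mul m n p (M : 'M[F]_(m, n)) (N : 'M[F]_(n, p)) c d :
  opbound M c -> opbound N d -> opbound (M *m N) (c * d).
Proof.
move=> [c0 hM] [d0 hN]; split=> [|x]; first exact: mulr_ge0.
rewrite -mulmxA; apply: le_trans (hM _) _; rewrite -mulrA.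
exact: ler_wpM2l.
Qed.

Lemma opboundD m n (M N : 'M[F]_(m, n)) c d :
  opbound M c -> opbound N d -> opbound (M + N) (c + d).
Proof.
move=> [c0 hM] [d0 hN]; split=> [|x]; first exact: addr_ge0.
by rewrite mulmxDl mulrDl; apply: le_trans (ler_frobD _ _) (lerD _ _).
Qed.

(** For [y = M^* x], the square of the norm of [y] is [<x, M y>], at most [c |x| |y|]; then [|y|]
    cancels. *)
Lemma opbound_ctmx m n (M : 'M[F]_(m, n)) c : opbound M c -> opbound (ctmx M) c.
Proof.
move=> [c0 hM]; split=> // x; set y := ctmx M *m x.
have [->|y0] := eqVneq (fnorm y) 0; first by rewrite mulr_ge0 // frob_ge0.
have y_gt0 : 0 < fnorm y by rewrite lt_neqAle eq_sym y0 frob_ge0.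
rewrite -(ler_pM2r y_gt0) -expr2 -[leLHS](@rnorm_ofR R k) ?sqr_ge0 //.
rewrite -edot_norm edotE {1}/y ctmxM ctmxK -mulmxA -edotE.
apply: le_trans (ler_edot _ _) _; rewrite mulrAC [leRHS]mulrC.
by rewrite ler_wpM2l ?frob_ge0.
Qed.

(** After taking adjoints, [N^*] acts on the columns of [M^*], where the vector bound applies. *)
Lemma fnorm_mulr m n p (M : 'M[F]_(m, n)) (N : 'M[F]_(n, p)) c :
  opbound N c -> fnorm (M *m N) <= fnorm M * c.
Proof.
move=> /opbound_ctmx [c0 hN].
rewrite -fnorm_ctmx -(fnorm_ctmx M) ctmxM mulrC.
by apply: frob_le_cols => // j; rewrite colE -mulmxA -colE; exact: hN.
Qed.

Lemma opbound_fnorm m n (M : 'M[F]_(m, n)) : opbound M (fnorm M).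
Proof.
split=> [|x]; first exact: frob_ge0.
(* The vector [x] is read as an operator from [F^1], for which its own norm is an operator bound. *)
apply: fnorm_mulr; split; first exact: frob_ge0.
move=> a; rewrite [a]mx11_scalar mul_mx_scalar.
rewrite /fnorm /frob -sqrtrM; last by apply: sumr_ge0 => i _; apply: sumsq_ge0.
apply: ler_wsqrtr.
rewrite big_ord1 big_ord1 mulr_suml; apply: ler_sum => i _.
by rewrite !big_ord1 !mxE !rnormM exprMn mulrC eqxx mulr1n.
Qed.

End Euclidean.

(** * Products of Bochner and classical matrices, and Gram matrices *)

Section BochnerAlgebra.
Variables (R : realType) (k : RorC_kind) (H : hilbertType R k).
Local Notation F := (RorC R k).

Lemma innerDr (x y z : H) : inner x (y + z) = inner x y + inner x z.
Proof. by rewrite -[y]scale1r inner_linearr mul1r scale1r. Qed.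

Lemma inner0r (x : H) : inner x (0 : H) = 0.
Proof. by apply: (addrI (inner x 0)); rewrite -innerDr !addr0. Qed.

Lemma innerZr (x y : H) (a : F) : inner x (a *: y) = a * inner x y.
Proof. by rewrite -[a *: y]addr0 inner_linearr inner0r addr0. Qed.

Lemma inner_sumr (T : finType) (x : H) (y : T -> H) :
  inner x (\sum_i y i) = \sum_i inner x (y i).
Proof. exact: (big_morph _ (innerDr x) (inner0r x)). Qed.

Lemma mulHFA m n p q (A : 'M[H]_(m, n)) (M : 'M[F]_(n, p)) (N : 'M[F]_(p, q)) :
  mulHF (mulHF A M) N = mulHF A (M *m N).
Proof.
apply/matrixP => i j; rewrite !mxE.
under eq_bigr do rewrite mxE scaler_sumr.
rewrite exchange_big; apply: eq_bigr => l _ /=.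
rewrite mxE scaler_suml; apply: eq_bigr => h _.
by rewrite scalerA mulrC.
Qed.

Lemma mulHFDl m n p (A B : 'M[H]_(m, n)) (M : 'M[F]_(n, p)) :
  mulHF (A + B) M = mulHF A M + mulHF B M.
Proof.
apply/matrixP => i j; rewrite !mxE -big_split; apply: eq_bigr => l _.
by rewrite mxE scalerDr.
Qed.

Lemma mulHFNl m n p (A : 'M[H]_(m, n)) (M : 'M[F]_(n, p)) :
  mulHF (- A) M = - mulHF A M.
Proof.
apply/matrixP => i j; rewrite !mxE -sumrN; apply: eq_bigr => l _.
by rewrite mxE scalerN.
Qed.

Lemma mulHFDr m n p (A : 'M[H]_(m, n)) (M N : 'M[F]_(n, p)) :
  mulHF A (M + N) = mulHF A M + mulHF A N.
Proof.
apply/matrixP => i j; rewrite !mxE -big_split; apply: eq_bigr => l _.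
by rewrite mxE scalerDl.
Qed.

Lemma mulHFNr m n p (A : 'M[H]_(m, n)) (M : 'M[F]_(n, p)) :
  mulHF A (- M) = - mulHF A M.
Proof.
apply/matrixP => i j; rewrite !mxE -sumrN; apply: eq_bigr => l _.
by rewrite mxE scaleNr.
Qed.

Lemma mulHF1 m n (A : 'M[H]_(m, n)) : mulHF A 1%:M = A.
Proof.
apply/matrixP => i j; rewrite mxE (bigD1 j) //= mxE eqxx scale1r.
by rewrite big1 ?addr0 // => l lj; rewrite mxE (negPf lj) scale0r.
Qed.

Lemma mulHF0 m n p (A : 'M[H]_(m, n)) : mulHF A (0 : 'M[F]_(n, p)) = 0.
Proof. by rewrite -(subrr 0) mulHFDr mulHFNr subrr. Qed.

Lemma col_mulHF m n p (A : 'M[H]_(m, n)) (M : 'M[F]_(n, p)) j :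
  col j (mulHF A M) = mulHF A (col j M).
Proof.
by apply/matrixP => i l; rewrite !mxE; apply: eq_bigr => h _; rewrite mxE.
Qed.

Lemma subrows_mulHF m n p (A : 'M[H]_(m, n)) (M : 'M[F]_(n, p)) I :
  subrows (mulHF A M) I = mulHF (subrows A I) M.
Proof.
by apply/matrixP => i l; rewrite !mxE; apply: eq_bigr => h _; rewrite mxE.
Qed.

Lemma subcols_mulHF m n p (A : 'M[H]_(m, n)) (M : 'M[F]_(n, p)) J :
  subcols (mulHF A M) J = mulHF A (subcols M J).
Proof.
by apply/matrixP => i l; rewrite !mxE; apply: eq_bigr => h _; rewrite mxE.
Qed.

Lemma mulHF_row_mx m n1 n2 p (A1 : 'M[H]_(m, n1)) (A2 : 'M[H]_(m, n2))
    (M1 : 'M[F]_(n1, p)) (M2 : 'M[F]_(n2, p)) :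
  mulHF (row_mx A1 A2) (col_mx M1 M2) = mulHF A1 M1 + mulHF A2 M2.
Proof.
apply/matrixP => i j; rewrite !mxE big_split_ord /=.
congr (_ + _); apply: eq_bigr => l _; first by rewrite row_mxEl col_mxEu.
by rewrite row_mxEr col_mxEd.
Qed.

Lemma mulHF_mx_row m n p1 p2 (A : 'M[H]_(m, n)) 
    (M1 : 'M[F]_(n, p1)) (M2 : 'M[F]_(n, p2)) :
  mulHF A (row_mx M1 M2) = row_mx (mulHF A M1) (mulHF A M2).
Proof.
apply/matrixP => i j; rewrite !mxE; case: split_ordP => l ->; rewrite mxE.
  by apply: eq_bigr => h _; rewrite row_mxEl.
by apply: eq_bigr => h _; rewrite row_mxEr.
Qed.

Lemma mulFH_tr m n p (M : 'M[F]_(m, n)) (A : 'M[H]_(n, p)) :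
  (mulFH M A)^T = mulHF A^T M^T.
Proof.
by apply/matrixP => i l; rewrite !mxE; apply: eq_bigr => h _; rewrite !mxE.
Qed.

(** The classical matrix [A^* B], through which all adjoints of Bochner matrices are handled. *)
Definition gram m n p (A : 'M[H]_(m, n)) (B : 'M[H]_(m, p)) : 'M[F]_(n, p) :=
  \matrix_(i, j) \sum_l inner (A l i) (B l j).

Lemma columnwise_hadj m n p (A : 'M[H]_(m, n)) (B : 'M[H]_(m, p)) :
  columnwise (hadj A) B = gram A B.
Proof.
by apply/matrixP => i j; rewrite !mxE; apply: eq_bigr => l _; rewrite mxE.
Qed.

Lemma hdot_gram m (x y : 'cV[H]_m) : hdot x y = gram x y 0 0.
Proof. by rewrite mxE. Qed.

Lemma ctmx_gram m n p (A : 'M[H]_(m, n)) (B : 'M[H]_(m, p)) :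
  ctmx (gram A B) = gram B A.
Proof.
apply/matrixP => i j; rewrite !mxE rmorph_sum; apply: eq_bigr => l _.
by rewrite [RHS]innerC.
Qed.

Lemma gramDr m n p (A : 'M[H]_(m, n)) (B C : 'M[H]_(m, p)) :
  gram A (B + C) = gram A B + gram A C.
Proof.
apply/matrixP => i j; rewrite !mxE -big_split; apply: eq_bigr => l _.
by rewrite mxE innerDr.
Qed.

Lemma gramMr m n p q (A : 'M[H]_(m, n)) (B : 'M[H]_(m, p)) (M : 'M[F]_(p, q)) :
  gram A (mulHF B M) = gram A B *m M.
Proof.
apply/matrixP => i j; rewrite !mxE.
under eq_bigr do rewrite mxE inner_sumr.
rewrite exchange_big; apply: eq_bigr => l _ /=.
by rewrite mxE mulr_suml; apply: eq_bigr => h _; rewrite innerZr mulrC.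
Qed.

Lemma gramNr m n p (A : 'M[H]_(m, n)) (B : 'M[H]_(m, p)) :
  gram A (- B) = - gram A B.
Proof.
rewrite -{1}[B]mulHF1 -mulHFNr gramMr mulmxN mulmx1 //.
Qed.

Lemma gramMl m n p q (A : 'M[H]_(m, n)) (B : 'M[H]_(m, p)) (M : 'M[F]_(n, q)) :
  gram (mulHF A M) B = ctmx M *m gram A B.
Proof. by rewrite -ctmx_gram gramMr ctmxM ctmx_gram. Qed.

Lemma hdot_norm m (x : 'cV[H]_m) : hdot x x = ofR R k (frob x ^+ 2).
Proof.
rewrite frob_sqr rmorph_sum; apply: eq_bigr => i _.
by rewrite big_ord1 rmorphXn /= inner_norm ofR_rnorm.
Qed.

Lemma frob_isometry m d n (Q : 'M[H]_(m, d)) (X : 'M[F]_(d, n)) :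
  gram Q Q = 1%:M -> frob (mulHF Q X) = fnorm X.
Proof.
move=> QQ; apply/eqP; rewrite -(eqrXn2 (n := 2)) ?frob_ge0 //; apply/eqP.
rewrite !frob_sqr_col; apply: eq_bigr => j _; rewrite col_mulHF.
apply: (@ofR_inj R k); rewrite -hdot_norm -[in RHS]edot_norm.
by rewrite hdot_gram gramMl gramMr QQ mul1mx edotE.
Qed.

End BochnerAlgebra.

(** * Orthonormal factorization in [H^m] *)

Section GramSchmidt.
Variables (R : realType) (k : RorC_kind) (H : hilbertType R k).
Local Notation F := (RorC R k).
Local Notation ofR := (ofR R k).

Lemma gram_row_mx m n1 n2 p1 p2 (A1 : 'M[H]_(m, n1)) (A2 : 'M[H]_(m, n2))
    (B1 : 'M[H]_(m, p1)) (B2 : 'M[H]_(m, p2)) :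
  gram (row_mx A1 A2) (row_mx B1 B2) =
  block_mx (gram A1 B1) (gram A1 B2) (gram A2 B1) (gram A2 B2).
Proof.
apply/matrixP => i j; rewrite mxE.
case: (split_ordP i) => a ->; case: (split_ordP j) => b ->;
  rewrite ?block_mxEul ?block_mxEur ?block_mxEdl ?block_mxEdr mxE;
  apply: eq_bigr => l _; by rewrite ?row_mxEl ?row_mxEr.
Qed.

(** Induction on the columns, each new one being added on the left. The right inverse [Y] records
    that [X] has full row rank, so that [d] is the rank of [A]. *)
Lemma gram_schmidt m n (A : 'M[H]_(m, n)) :
  exists d (Q : 'M[H]_(m, d)) (X : 'M[F]_(d, n)) (Y : 'M[F]_(n, d)),
    [/\ gram Q Q = 1%:M, X *m Y = 1%:M & A = mulHF Q X].
Proof.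
elim: n A => [|n IH] A.
  exists 0, A, 1%:M, 1%:M; rewrite mulmx1 mulHF1; split=> //.
  by apply/matrixP => -[].
move: A; rewrite -[n.+1]/(1 + n)%N => A.
have [d [Q [X [Y [QQ XY AE]]]]] := IH (rsubmx A).
pose a := lsubmx A; pose c := gram Q a; pose u := a - mulHF Q c.
have Qu : gram Q u = 0 by rewrite gramDr gramNr gramMr QQ mul1mx subrr.
have auc : a = u + mulHF Q c by rewrite /u subrK.
rewrite -[A]hsubmxK -/a AE.
(* If the residual [u] vanishes, the new column lies in the span of [Q] and [d] stays; otherwise
   [u], normalized, joins [Q] as a first column. *)
have [u0|u_neq0] := eqVneq u 0.
  exists d, Q, (row_mx c X), (col_mx 0 Y); split=> //.
    by rewrite mul_row_col mulmx0 add0r.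
  by rewrite mulHF_mx_row auc u0 add0r.
pose nu := ofR (frob u).
have nu0 : nu != 0.
  by apply: contra u_neq0; rewrite fmorph_eq0 => /eqP /frob0_eq0 ->.
have uu : gram u u = (nu ^+ 2)%:M.
  rewrite [LHS]mx11_scalar -hdot_gram hdot_norm rmorphXn //.
have conj_nuV : conjF R k nu^-1 = nu^-1 by rewrite fmorphV conjF_ofR.
have ctmx_nuV : ctmx (nu^-1%:M : 'M[F]_1) = nu^-1%:M.
  by rewrite /ctmx tr_scalar_mx map_scalar_mx conj_nuV.
(* The new [X] is block lower triangular, and its right inverse is found by block substitution. *)
exists (1 + d)%N, (row_mx (mulHF u nu^-1%:M) Q),
  (block_mx nu%:M 0 c X), (block_mx nu^-1%:M 0 (- (Y *m (nu^-1 *: c))) Y).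
split.
- rewrite gram_row_mx !gramMl !gramMr uu QQ Qu mul0mx ctmx_nuV.
  rewrite -(ctmx_gram Q u) Qu /ctmx trmx0 map_mx0 mulmx0 -!scalar_mxM.
  rewrite expr2 -mulrA mulfV // mulr1 mulVf //.
  by rewrite -scalar_mx_block.
- rewrite mulmx_block !mulmx0 !mul0mx !addr0 add0r XY -scalar_mxM mulfV //.
  rewrite mulmxN mulmxA XY mul1mx mul_mx_scalar subrr.
  by rewrite -scalar_mx_block.
- rewrite /block_mx mulHF_row_mx !mulHF_mx_row mulHFA -scalar_mxM mulVf //.
  rewrite mulHF1 mulHF0.
  by rewrite add_row_mx add0r -auc.
Qed.

Lemma frob_mulHF m n p (A : 'M[H]_(m, n)) (N : 'M[F]_(n, p)) c :
  opbound N c -> frob (mulHF A N) <= frob A * c.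
Proof.
move=> hN; have [d [Q [X [_ [QQ _ ->]]]]] := gram_schmidt A.
by rewrite mulHFA !frob_isometry //; exact: fnorm_mulr.
Qed.

End GramSchmidt.

(** * Uniqueness of solutions of the Penrose equations *)

Section PinvTheory.
Variables (F : Type) (X : choiceType) (Y : Type) (x0 : X).
Variables (dotX : X -> X -> F) (dotY : Y -> Y -> F).
Hypothesis dotX_inj : forall x x', (forall z, dotX x z = dotX x' z) -> x = x'.
Hypothesis dotY_inj : forall y y', (forall z, dotY y z = dotY y' z) -> y = y'.

(** Selfadjointness and [f h f = f = f g f] give [f g = f h] and [g f = h f]; then
    [g = g f g = g f h = h f h = h]. *)
Lemma is_pinv_uniq f g h :
  is_pinv dotX dotY f g -> is_pinv dotX dotY f h -> g =1 h.
Proof.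
move=> [fgf gfg fg gf] [fhf hfh fh hf] y.
have fgh z : f (g z) = f (h z).
  apply: dotY_inj => w.
  by rewrite -[f (g z)]fhf fh fg fgf -fh.
have gfh x : g (f x) = h (f x).
  apply: dotX_inj => w.
  by rewrite gf hf -{1}[f w]fhf -hf -gf -hf fgf.
by rewrite -gfg fgh gfh hfh.
Qed.

(** The pseudoinverse is defined by choice; any explicit solution identifies it. *)
Lemma pinvE f g : is_pinv dotX dotY f g -> Defs.pinv x0 dotX dotY f =1 g.
Proof.
move=> fg; apply: (is_pinv_uniq _ fg).
exact: (xgetI (P := [set g | is_pinv dotX dotY f g]%classic) _ fg).
Qed.

End PinvTheory.

(** * Operator norms as suprema *)

Section OperatorNorm.
Variables (R : realType) (X Y : Type) (nX : X -> R) (nY : Y -> R).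
Hypothesis nX_ge0 : forall x, 0 <= nX x.
Hypothesis nY_ge0 : forall y, 0 <= nY y.

Lemma opnorm_ge0 (f : X -> Y) : 0 <= opnorm nX nY f.
Proof.
rewrite /opnorm; set E := (X in sup X).
(* A set that is empty or unbounded above has [sup] equal to 0 by convention. *)
have [[[y Ey] ubE]|/sup_out ->] := pselect (has_sup E); last by [].
apply: le_trans (ub_le_sup ubE Ey).
by case: Ey => x _ <-.
Qed.

(** Rescaling [x] to norm 1 puts it into the set of the supremum. The maps [sX] and [sY] stand for
    multiplication by real scalars, since [X] and [Y] are bare types; [C] serves to make the
    supremum finite. *)
Lemma opnorm_le (sX : R -> X -> X) (sY : R -> Y -> Y) (f : X -> Y) (C : R) :
  (forall a x, 0 <= a -> nX (sX a x) = a * nX x) ->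
  (forall a y, 0 <= a -> nY (sY a y) = a * nY y) ->
  (forall a x, f (sX a x) = sY a (f x)) ->
  (forall x, nY (f x) <= C * nX x) ->
  forall x, nY (f x) <= opnorm nX nY f * nX x.
Proof.
move=> hX hY hf fC x.
have [x0|x_neq0] := eqVneq (nX x) 0.
  by apply: le_trans (fC x) _; rewrite x0 !mulr0.
have x_gt0 : 0 < nX x by rewrite lt_neqAle eq_sym x_neq0 nX_ge0.
have xV_ge0 : 0 <= (nX x)^-1 by rewrite invr_ge0.
rewrite -ler_pdivrMr // mulrC -hY // -hf.
apply: ub_le_sup; last first.
  by exists (sX (nX x)^-1 x) => //=; rewrite hX // mulVf.
exists (Num.max C 0) => _ [z /= z1 <-].
apply: le_trans (fC z) _; apply: le_trans (_ : Num.max C 0 * nX z <= _).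
  by rewrite ler_wpM2r // le_max lexx.
by rewrite -[leRHS]mulr1 ler_wpM2l // le_max lexx orbT.
Qed.

End OperatorNorm.

(** * Explicit pseudoinverses and their projections *)

Section Pseudoinverses.
Variables (R : realType) (k : RorC_kind).
Local Notation F := (RorC R k).
Local Notation ofR := (ofR R k).

Lemma frobZ (V : normedModType F) m n (a : R) (A B : 'M[V]_(m, n)) :
  0 <= a -> (forall i j, B i j = ofR a *: A i j) -> frob B = a * frob A.
Proof.
move=> a0 BA; rewrite -[a in RHS](ger0_norm a0) -sqrtr_sqr -sqrtrM ?sqr_ge0 //.
congr Num.sqrt; rewrite mulr_sumr; apply: eq_bigr => i _.
rewrite mulr_sumr; apply: eq_bigr => j _.
by rewrite BA rnormZ exprMn rnorm_ofR.
Qed.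

Lemma fnorm_scalar m (x : 'cV[F]_m) a :
  0 <= a -> fnorm (x *m (ofR a)%:M) = a * fnorm x.
Proof. by move=> a0; apply: frobZ => // i j; rewrite mul_mx_scalar mxE. Qed.

Lemma edot_inj n (x x' : 'cV[F]_n) : (forall z, edot x z = edot x' z) -> x = x'.
Proof.
move=> xx'; apply/eqP; rewrite -subr_eq0; apply/eqP.
apply: (@frob0_eq0 R k F^o); apply/eqP.
rewrite -(sqrf_eq0 (fnorm _)); apply/eqP.
apply: (@ofR_inj R k); rewrite -edot_norm rmorph0.
rewrite -[LHS]conjFK -(rmorph0 (conjF R k)); congr (conjF R k _).
have edotC u v : conjF R k (edot u v) = edot v u :> F.
  rewrite rmorph_sum; apply: eq_bigr => i _.
  by rewrite rmorphM /= conjFK mulrC.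
rewrite edotC edotE mulmxBr mxE [X in _ + X]mxE -!edotE.
by rewrite -edotC xx' edotC subrr.
Qed.

(* [T] is the Moore--Penrose inverse X^* (X X^* )^-1. *)
Lemma surjective_pinv d n (X : 'M[F]_(d, n)) (Y : 'M[F]_(n, d)) :
  X *m Y = 1%:M ->
  exists T : 'M[F]_(n, d), X *m T = 1%:M /\ ctmx (T *m X) = T *m X.
Proof.
move=> XY; pose K := X *m ctmx X.
have Kunit : K \in unitmx.
  (* If [v K = 0], then [v X X^* v^* = 0], so [v X = 0], and the right inverse [Y] gives [v = 0]. *)
  rewrite -row_free_unit; apply: inj_row_free => v vK.
  suff vX : v *m X = 0 by rewrite -[v]mulmx1 -XY mulmxA vX mul0mx.
  rewrite -[v *m X]ctmxK; suff -> : ctmx (v *m X) = 0.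
    by rewrite /ctmx trmx0 map_mx0.
  apply: (@frob0_eq0 R k F^o); apply/eqP; rewrite -(sqrf_eq0 (fnorm _)).
  apply/eqP; apply: (@ofR_inj R k); rewrite -edot_norm rmorph0 edotE ctmxK.
  by rewrite ctmxM mulmxA -(mulmxA v) -/K vK mul0mx mxE.
have Kherm : ctmx K = K by rewrite ctmxM ctmxK.
exists (ctmx X *m invmx K); split; first by rewrite mulmxA mulmxV.
have KV : ctmx (invmx K) = invmx K.
  by rewrite /ctmx trmx_inv map_invmx -/(ctmx K) Kherm.
by rewrite !ctmxM ctmxK KV mulmxA.
Qed.

Lemma epinvE m n (M : 'M[F]_(m, n)) (T : 'M[F]_(n, m)) :
  M *m T *m M = M -> T *m M *m T = T ->
  ctmx (M *m T) = M *m T -> ctmx (T *m M) = T *m M ->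
  epinv M =1 mulmx T.
Proof.
move=> MTM TMT hMT hTM; apply: pinvE; [exact: edot_inj|exact: edot_inj|].
split=> [x|y|y y'|x x'].
- by rewrite !mulmxA MTM.
- by rewrite !mulmxA TMT.
- by rewrite !edotE !mulmxA ctmxM hMT !mulmxA.
- by rewrite !edotE !mulmxA ctmxM hTM !mulmxA.
Qed.

Lemma eopnorm_opbound m n (f : 'cV[F]_n -> 'cV[F]_m) (T : 'M[F]_(m, n)) :
  f =1 mulmx T -> opbound T (eopnorm f).
Proof.
move=> fT; have fn_ge0 p (z : 'cV[F]_p) : 0 <= enorm z by exact: sqrtr_ge0.
split=> [|x]; first exact: opnorm_ge0.
rewrite -fT -!enorm_fnorm.
pose sc p a (z : 'cV[F]_p) := z *m (ofR a)%:M.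
have sc_norm p a (z : 'cV[F]_p) : 0 <= a -> enorm (sc p a z) = a * enorm z.
  by rewrite !enorm_fnorm; exact: fnorm_scalar.
apply: (@opnorm_le _ _ _ _ _ (@fn_ge0 n) (sc n) (sc m) _ (fnorm T)).
- exact: sc_norm.
- exact: sc_norm.
- by move=> a z; rewrite !fT /sc mulmxA.
- move=> z; rewrite fT !enorm_fnorm; exact: (opbound_fnorm T).2.
Qed.

Variable H : hilbertType R k.

Lemma trace_gram m n (A : 'M[H]_(m, n)) : \tr (gram A A) = ofR (frob A ^+ 2).
Proof.
rewrite frob_sqr exchange_big rmorph_sum; apply: eq_bigr => j _.
rewrite mxE rmorph_sum; apply: eq_bigr => i _.
by rewrite rmorphXn /= inner_norm ofR_rnorm.
Qed.

Lemma gram_eq0 m n (A : 'M[H]_(m, n)) : gram A A = 0 -> A = 0.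
Proof.
move=> AA; apply: frob0_eq0; apply/eqP; rewrite -sqrf_eq0; apply/eqP.
by apply: (@ofR_inj R k); rewrite -trace_gram AA mxtrace0 rmorph0.
Qed.

Lemma hdot_inj m (x x' : 'cV[H]_m) : (forall z, hdot x z = hdot x' z) -> x = x'.
Proof.
move=> xx'; apply/eqP; rewrite -subr_eq0; apply/eqP; apply: gram_eq0.
have e (z : 'cV[H]_m) : gram z x = gram z x'.
  rewrite -(ctmx_gram x) -(ctmx_gram x'); congr ctmx.
  by rewrite [LHS]mx11_scalar [RHS]mx11_scalar -!hdot_gram xx'.
by rewrite gramDr gramNr e subrr.
Qed.

(** For [g = T Q^*], the products are [A g = Q Q^*] and [g A = T X], both selfadjoint
    projections. *)
Lemma hpinvP m n (A : 'M[H]_(m, n)) :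
  exists d (Q : 'M[H]_(m, d)) (X : 'M[F]_(d, n)) (T : 'M[F]_(n, d)),
    [/\ gram Q Q = 1%:M, X *m T = 1%:M, ctmx (T *m X) = T *m X, A = mulHF Q X &
        hpinv A =1 fun y => T *m gram Q y].
Proof.
have [d [Q [X [Y [QQ XY AE]]]]] := gram_schmidt A.
have [T [XT TX]] := surjective_pinv XY.
exists d, Q, X, T; split=> //.
apply: pinvE; [exact: edot_inj|exact: hdot_inj|rewrite {}AE].
split=> [x|y|y y'|x x'].
- by rewrite !mulHFA gramMr QQ mul1mx (mulmxA X T) XT mul1mx.
- by rewrite mulHFA gramMr QQ mul1mx (mulmxA X T) XT mul1mx.
- rewrite !mulHFA !(mulmxA X T) XT !mul1mx !hdot_gram gramMl gramMr.
  by rewrite ctmx_gram.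
- by rewrite !mulHFA !gramMr QQ !mul1mx !mulmxA !edotE ctmxM TX !mulmxA.
Qed.

(** The classical matrix [A^+ B]; thus [mulHF A (hp A B)] projects the columns of [B] orthogonally
    onto the range of [A]. *)
Definition hp m n p (A : 'M[H]_(m, n)) (B : 'M[H]_(m, p)) : 'M[F]_(n, p) :=
  columnwise (hpinv A) B.

Lemma columnwiseE m n p d (f : 'cV[H]_m -> 'cV[F]_n) (T : 'M[F]_(n, d))
    (Q : 'M[H]_(m, d)) (B : 'M[H]_(m, p)) :
  f =1 (fun y => T *m gram Q y) -> columnwise f B = T *m gram Q B.
Proof.
move=> fE; apply/matrixP => i j; rewrite mxE fE !mxE; apply: eq_bigr => l _.
by rewrite !mxE; congr (_ * _); apply: eq_bigr => h _; rewrite mxE.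
Qed.

Section Projection.
Variables (m n : nat) (A : 'M[H]_(m, n)).

Lemma hpD p (B C : 'M[H]_(m, p)) : hp A (B + C) = hp A B + hp A C.
Proof.
have [d [Q [X [T [_ _ _ _ h]]]]] := hpinvP A.
by rewrite /hp !(columnwiseE _ h) gramDr mulmxDr.
Qed.

Lemma hpN p (B : 'M[H]_(m, p)) : hp A (- B) = - hp A B.
Proof.
have [d [Q [X [T [_ _ _ _ h]]]]] := hpinvP A.
by rewrite /hp !(columnwiseE _ h) gramNr mulmxN.
Qed.

Lemma hpM p q (B : 'M[H]_(m, p)) (N : 'M[F]_(p, q)) :
  hp A (mulHF B N) = hp A B *m N.
Proof.
have [d [Q [X [T [_ _ _ _ h]]]]] := hpinvP A.
by rewrite /hp !(columnwiseE _ h) gramMr mulmxA.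
Qed.

Lemma mulHF_hp_self : mulHF A (hp A A) = A.
Proof.
have [d [Q [X [T [QQ XT _ AE h]]]]] := hpinvP A.
by rewrite /hp !(columnwiseE _ h) AE gramMr QQ mul1mx mulHFA mulmxA XT mul1mx.
Qed.

(** The two parts have zero cross Gram matrices, and the squared norm is the trace of the Gram
    matrix. *)
Lemma frob_proj_pythagoras p (B : 'M[H]_(m, p)) :
  frob B ^+ 2 = frob (mulHF A (hp A B)) ^+ 2 + frob (B - mulHF A (hp A B)) ^+ 2.
Proof.
have [d [Q [X [T [QQ XT _ AE h]]]]] := hpinvP A.
rewrite /hp !(columnwiseE _ h) {}AE mulHFA mulmxA XT mul1mx.
set a := mulHF Q _; set b := B - a.
have ab : gram a b = 0.
  by rewrite gramMl gramDr gramNr gramMr QQ mul1mx subrr mulmx0.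
have ba : gram b a = 0 by rewrite -ctmx_gram ab /ctmx trmx0 map_mx0.
apply: (@ofR_inj R k); rewrite rmorphD -!trace_gram -mxtraceD; congr (\tr _).
have -> : B = a + b by rewrite addrC subrK.
clearbody a b => {h}.
have gramDl (x : 'M[H]_(m, p)) : gram (a + b) x = gram a x + gram b x.
  rewrite -(ctmx_gram x) gramDr /ctmx linearD map_mxD.
  by rewrite -!/(ctmx _) !ctmx_gram.
by rewrite gramDl !gramDr ab ba addr0 add0r.
Qed.

Lemma frob_proj p (B : 'M[H]_(m, p)) : frob (mulHF A (hp A B)) <= frob B.
Proof.
by rewrite -ler_sqr ?nnegrE ?frob_ge0 //
  [leRHS]frob_proj_pythagoras lerDl sqr_ge0.
Qed.

Lemma frob_coproj p (B : 'M[H]_(m, p)) : frob (B - mulHF A (hp A B)) <= frob B.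
Proof.
by rewrite -ler_sqr ?nnegrE ?frob_ge0 //
  [leRHS]frob_proj_pythagoras lerDr sqr_ge0.
Qed.

(** [A^+ A] is an orthogonal projection: its value [y] at [x] satisfies [<y, y> = <x, y>], and
    Cauchy--Schwarz concludes. *)
Lemma opbound_hp_self : opbound (hp A A) 1.
Proof.
have [d [Q [X [T [QQ XT TX AE h]]]]] := hpinvP A.
have -> : hp A A = T *m X.
  by rewrite /hp !(columnwiseE _ h) AE gramMr QQ mul1mx.
split=> // x; rewrite mul1r; set y := T *m X *m x.
have [->|y0] := eqVneq (fnorm y) 0; first exact: frob_ge0.
have y_gt0 : 0 < fnorm y by rewrite lt_neqAle eq_sym y0 frob_ge0.
rewrite -(ler_pM2r y_gt0) -expr2 -[leLHS](@rnorm_ofR R k) ?sqr_ge0 //.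
rewrite -edot_norm; suff -> : edot y y = edot x y by exact: ler_edot.
rewrite !edotE {1}/y ctmxM TX -mulmxA; congr ((_ *m _) 0 0).
by rewrite /y !mulmxA -(mulmxA T X T) XT mulmx1.
Qed.

Lemma fnorm_hp p (B : 'M[H]_(m, p)) :
  fnorm (hp A B) <= hopnorm (hpinv A) * frob B.
Proof.
have [d [Q [X [T [QQ XT _ AE h]]]]] := hpinvP A.
have hn_ge0 (z : 'cV[H]_m) : 0 <= hnorm z by exact: sqrtr_ge0.
have en_ge0 (z : 'cV[F]_n) : 0 <= enorm z by exact: sqrtr_ge0.
apply: frob_le_cols => [|j]; first exact: opnorm_ge0.
have -> : col j (hp A B) = hpinv A (col j B).
  by apply/matrixP => i l; rewrite ord1 !mxE.
rewrite -[leLHS]enorm_fnorm.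
apply: (@opnorm_le _ _ _ _ _ hn_ge0 (fun a z => mulHF z (ofR a)%:M)
  (fun a z => z *m (ofR a)%:M) _ (fnorm T)) => //.
- move=> a z a0; apply: frobZ => // i l.
  by rewrite mxE big_ord1 !ord1 !mxE eqxx.
- by move=> a z a0; rewrite !enorm_fnorm fnorm_scalar.
- by move=> a z; rewrite !h gramMr mulmxA.
- move=> z; rewrite h enorm_fnorm.
  apply: le_trans ((opbound_fnorm T).2 _) _.
  apply: ler_wpM2l; first exact: frob_ge0.
  (* The norm of [Q^* z] is that of [Q Q^* z], the projection of [z] onto the range of [A]. Hence
     [fnorm T] bounds the pseudoinverse and its supremum is finite. *)
  rewrite -(frob_isometry _ QQ).
  have <- : mulHF A (hp A z) = mulHF Q (gram Q z); last exact: frob_proj.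
  by rewrite /hp (columnwiseE _ h) AE mulHFA mulmxA XT mul1mx.
Qed.

End Projection.

End Pseudoinverses.

(** * Consequences of the rank hypothesis *)

Section CrossApproximation.
Variables (R : realType) (k : RorC_kind) (H : hilbertType R k).
Local Notation F := (RorC R k).

(** The orthonormal factor [Q] is a range basis, so the choice in [hrank] does not fall back to its
    default 0. *)
Lemma hrank_basis m n (A : 'M[H]_(m, n)) :
  exists b : 'M[H]_(m, hrank A), is_range_basis A b.
Proof.
have [d [Q [X [Y [QQ XY AE]]]]] := gram_schmidt A.
apply: (@xgetI _ _
  [set r | exists b : 'M[H]_(m, r), is_range_basis A b]%classic d).
exists Q; split=> [x y xy|].
  by rewrite -[x]mul1mx -[y]mul1mx -QQ -!gramMr xy.
apply/seteqP; split=> _ [x _ <-] /=.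
  by exists (Y *m x) => //; rewrite AE mulHFA mulmxA XY mul1mx.
by exists (X *m x) => //; rewrite AE mulHFA.
Qed.

(** A range basis [b] is [A N = U T] with [T = M N] square. Injectivity of [b] makes [T] invertible,
    so [U = b T^-1] is injective and [N T^-1] is a right inverse of [M]. *)
Lemma hrank_factor m n r (A : 'M[H]_(m, n)) (U : 'M[H]_(m, r))
    (M : 'M[F]_(r, n)) :
  hrank A = r -> A = mulHF U M ->
  injective (fun x : 'cV[F]_r => mulHF U x) /\
  exists N : 'M[F]_(n, r), M *m N = 1%:M.
Proof.
have [b [b_inj b_range]] := hrank_basis A.
move=> rA AE; rewrite rA in b b_inj b_range.
have /choice[y yP] (j : 'I_r) : exists y : 'cV[F]_n, mulHF A y = col j b.
  have : range (fun x : 'cV[F]_r => mulHF b x) (col j b).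
    by exists (col j 1%:M) => //; rewrite -col_mulHF mulHF1.
  by rewrite b_range => -[x _ <-]; exists x.
pose N : 'M[F]_(n, r) := \matrix_(i, j) y j i 0; pose T := M *m N.
have bT : b = mulHF U T.
  rewrite /T -mulHFA -AE; apply/matrixP => i j.
  have -> : b i j = col j b i 0 by rewrite mxE.
  by rewrite -yP !mxE; apply: eq_bigr => l _; rewrite mxE.
have Tunit : T \in unitmx.
  rewrite -unitmx_tr -row_free_unit; apply: inj_row_free => v vT.
  have Tv : T *m v^T = 0 by rewrite -[T]trmxK -trmx_mul vT trmx0.
  have : mulHF b v^T = mulHF b 0 by rewrite bT !mulHFA Tv mulmx0.
  by move=> /b_inj /(congr1 trmx); rewrite trmxK trmx0.
split=> [x z xz|]; last by exists (N *m invmx T); rewrite mulmxA mulmxV.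
have : mulHF b (invmx T *m x) = mulHF b (invmx T *m z).
  by rewrite bT !mulHFA !mulmxA mulmxV // !mul1mx.
by move=> /b_inj /(congr1 (mulmx T)); rewrite !mulmxA mulmxV // !mul1mx.
Qed.

Lemma submatrixE (V : Type) m n (A : 'M[V]_(m, n)) I J :
  submatrix A I J = subcols (subrows A I) J.
Proof. by apply/matrixP => i j; rewrite !mxE. Qed.

Lemma subcols_ctmx m n (V : 'M[F]_(n, m)) J :
  subcols (ctmx V) J = ctmx (subrows V J).
Proof. by apply/matrixP => i j; rewrite !mxE. Qed.

Lemma svd_submatrix m n r (B : 'M[H]_(m, n)) (U : 'M[H]_(m, r)) S V I J :
  is_svd B U S V -> hrank (submatrix B I J) = hrank B ->
  injective (fun x : 'cV[F]_r => mulHF (subrows U I) x) /\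
  exists Y, ctmx (subrows V J) *m Y = 1%:M.
Proof.
move=> [rB _ _ _ BE] rk; rewrite -rB in rk.
have BIJ : submatrix B I J =
    mulHF (subrows U I) (diag_mx S *m ctmx (subrows V J)).
  rewrite BE submatrixE !subrows_mulHF subcols_mulHF subcols_ctmx.
  by rewrite mulHFA.
have [U_inj [N hN]] := hrank_factor rk BIJ.
split=> //; exists (N *m diag_mx S).
(* One-sided inverses of square matrices are two-sided, so the diagonal factor moves from the left
   to the right. *)
by rewrite mulmxA; apply: mulmx1C; rewrite mulmxA.
Qed.

Lemma hp_injective m n (A : 'M[H]_(m, n)) :
  injective (fun x : 'cV[F]_n => mulHF A x) -> hp A A = 1%:M.
Proof.
move=> A_inj; suff h (x : 'cV[F]_n) : hp A A *m x = x.
  apply/matrixP => i j.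
  have := congr1 (fun z : 'cV_n => z i 0) (h (col j 1%:M)).
  by rewrite colE mulmxA mulmx1 -!colE !mxE.
by apply: A_inj; rewrite -mulHFA mulHF_hp_self.
Qed.

Lemma epinv_surjective m n (M : 'M[F]_(m, n)) Y :
  M *m Y = 1%:M ->
  exists2 K, M *m K = 1%:M & opbound K (eopnorm (epinv M)).
Proof.
move=> /surjective_pinv[T [MT TM]]; exists T => //.
apply: eopnorm_opbound; apply: epinvE; rewrite ?MT ?mul1mx ?ctmx1 //.
by rewrite -mulmxA MT mulmx1.
Qed.

(** Pseudoinversion commutes with the adjoint, which preserves operator bounds. The norm of
    [Q(I,:)^+] thus bounds a right inverse of [Q(I,:)^*], as the transposed problem requires. *)
Lemma epinv_injective m n (M : 'M[F]_(m, n)) Y :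
  ctmx M *m Y = 1%:M ->
  exists2 K, ctmx M *m K = 1%:M & opbound K (eopnorm (epinv M)).
Proof.
move=> /surjective_pinv[T [MT TM]]; exists T => //.
have TM1 : ctmx T *m M = 1%:M by rewrite -[M]ctmxK -ctmxM MT ctmx1.
have MT' : M *m ctmx T = T *m ctmx M by rewrite -TM ctmxM ctmxK.
rewrite -[T]ctmxK; apply/opbound_ctmx/eopnorm_opbound.
apply: epinvE; rewrite ?TM1 ?mul1mx ?ctmx1 //.
  by rewrite -mulmxA TM1 mulmx1.
by rewrite MT' TM.
Qed.

Lemma opbound_isometry_ctmx n r (V : 'M[F]_(n, r)) :
  ctmx V *m V = 1%:M -> opbound (ctmx V) 1.
Proof.
move=> VV; apply: opbound_ctmx; split=> // x; rewrite mul1r.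
suff -> : fnorm (V *m x) = fnorm x by [].
apply/eqP; rewrite -(eqrXn2 (n := 2)) ?frob_ge0 //; apply/eqP.
apply: (@ofR_inj R k); rewrite -!edot_norm !edotE ctmxM.
by rewrite -mulmxA (mulmxA _ V) VV mul1mx.
Qed.

Lemma svd_row_factor m n r (B : 'M[H]_(m, n)) (U : 'M[H]_(m, r)) S V I J K c :
  is_svd B U S V -> ctmx (subrows V J) *m K = 1%:M -> opbound K c ->
  exists W, [/\ subrows B I = mulHF (submatrix B I J) W, 
    B = mulHF (subcols B J) W & opbound W c].
Proof.
move=> [_ [_ VV] _ _ BE] VK hK; exists (K *m ctmx V).
have hW : B = mulHF (subcols B J) (K *m ctmx V).
  rewrite {1}BE [in RHS]BE subcols_mulHF subcols_ctmx !mulHFA.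
  by rewrite (mulmxA _ K) VK mul1mx.
split=> //; last first.
  by rewrite -[c]mulr1; apply: opbound_mul hK (opbound_isometry_ctmx VV).
rewrite {1}hW subrows_mulHF; congr mulHF.
by apply/matrixP => i j; rewrite !mxE.
Qed.

(** * Projection errors and coefficients under perturbation *)

Section Bounds.
Variables (m n : nat) (A B E : 'M[H]_(m, n)) (I : {set 'I_m}) (J : {set 'I_n}).
Variables (W : 'M[F]_(#|J|, n)) (c : R).
Hypotheses (hA : A = B + E) (hW : opbound W c).
Hypothesis (hBI : subrows B I = mulHF (submatrix B I J) W).

Local Notation G := (submatrix A I J).
Local Notation EIJ := (submatrix E I J).
Local Notation e := (frob E).

Lemma frob_submatrix : frob EIJ <= e.
Proof.
by rewrite submatrixE; apply: le_trans (frob_subcols _ _) (frob_subrows _ _).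
Qed.

(** The perturbation [D] of the splitting [R = G W + D]. *)
Let X := subrows E I - mulHF EIJ W.

Lemma frob_perturbation : frob X <= (1 + c) * e.
Proof.
apply: le_trans (ler_frobB _ _) _; rewrite mulrDl mul1r.
apply: lerD (frob_subrows _ _) _.
apply: le_trans (frob_mulHF _ hW) _; rewrite mulrC.
by apply: ler_wpM2l; [case: hW | exact: frob_submatrix].
Qed.

Lemma subrows_perturbation : subrows A I = mulHF G W + X.
Proof.
have -> : G = submatrix B I J + EIJ.
  by rewrite hA; apply/matrixP => i j; rewrite !mxE.
rewrite mulHFDl -hBI /X -addrA (addrCA (mulHF EIJ W)) subrr addr0.
by rewrite hA; apply/matrixP => i j; rewrite !mxE.
Qed.

(** The projection [1 - G G^+] kills [G W] and does not increase the norm of the rest, so no factor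
    [||G^+||] arises. *)
Lemma frob_coproj_subrows :
  frob (subrows A I - mulHF G (hp G (subrows A I))) <= (1 + c) * e.
Proof.
rewrite subrows_perturbation hpD hpM mulHFDr -mulHFA mulHF_hp_self.
rewrite opprD addrACA subrr add0r.
exact: le_trans (frob_coproj _ _) frob_perturbation.
Qed.

(** In [G^+ G W + G^+ D], the first term has bound [c] because [G^+ G] is a projection; only the
    second, of order [E], involves [||G^+||]. *)
Lemma opbound_coefficients :
  opbound (hp G (subrows A I)) (c + hopnorm (hpinv G) * ((1 + c) * e)).
Proof.
rewrite subrows_perturbation hpD hpM -[X in opbound _ (X + _)]mul1r.
apply: opboundD; first exact: opbound_mul (opbound_hp_self _) hW.
have g0 : 0 <= hopnorm (hpinv G).
  by apply: opnorm_ge0 => z; exact: sqrtr_ge0.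
split=> [|x].
  by rewrite !mulr_ge0 ?frob_ge0 ?addr_ge0 //; case: hW.
apply: le_trans ((opbound_fnorm _).2 _) _.
apply: ler_wpM2r; first exact: frob_ge0.
apply: le_trans (fnorm_hp _ _) _.
exact: ler_wpM2l frob_perturbation.
Qed.

Variables (r : nat) (U : 'M[H]_(m, r)) (M : 'M[F]_(r, n)).
Hypotheses (hB : B = mulHF U M) (hBJ : B = mulHF (subcols B J) W).
Hypotheses (hU : gram U U = 1%:M).
Hypothesis (U_inj : injective (fun x : 'cV[F]_r => mulHF (subrows U I) x)).

Let a := hopnorm (hpinv (subrows U I)).
Let L p (N : 'M[H]_(#|I|, p)) := mulHF U (hp (subrows U I) N).

Lemma frob_column_cross :
  frob (B - mulHF (subcols A J) (hp G (subrows A I))) <=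
  a * ((1 + c) * e)
  + (1 + a) * e * (c + hopnorm (hpinv G) * ((1 + c) * e)).
Proof.
have a0 : 0 <= a by apply: opnorm_ge0 => z; exact: sqrtr_ge0.
have c0 : 0 <= c by case: hW.
(* [U] is an isometry, so [L] costs no more than [U(I,:)^+]. *)
have frobL p (N : 'M[H]_(#|I|, p)) : frob (L N) <= a * frob N.
  by rewrite frob_isometry //; exact: fnorm_hp.
have LD p (N N' : 'M[H]_(#|I|, p)) : L (N + N') = L N + L N'.
  by rewrite /L hpD mulHFDr.
have LM p q (N : 'M[H]_(#|I|, p)) (T : 'M[F]_(p, q)) :
    L (mulHF N T) = mulHF (L N) T.
  by rewrite /L hpM mulHFA.
(* Injectivity gives [U(I,:)^+ U(I,:) = 1], so [L] rebuilds all rows of [B(:,J)] from those in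
   [I]. *)
have LB : L (submatrix B I J) = subcols B J.
  rewrite submatrixE hB subrows_mulHF !subcols_mulHF LM; congr mulHF.
  by rewrite /L hp_injective // mulHF1.
have GE : G = submatrix B I J + EIJ.
  by rewrite hA; apply/matrixP => i j; rewrite !mxE.
have AJ : subcols A J = L G + (subcols E J - L EIJ).
  rewrite GE LD LB addrACA subrr addr0.
  by rewrite hA; apply/matrixP => i j; rewrite !mxE.
set Z := hp G _.
have GZ : mulHF G Z = mulHF G W + mulHF G (hp G X).
  by rewrite /Z subrows_perturbation hpD hpM mulHFDr -mulHFA mulHF_hp_self.
set Y := mulHF EIJ W.
(* Collecting the terms in [Y] leaves the projection of [E(I,:)] and the complementary projection of
   [Y]; bounding them separately gives [1 + c] with no norm of [G^+]. *)
have LGZ : L (mulHF G Z) =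
    B + L (mulHF G (hp G (subrows E I)) + (Y - mulHF G (hp G Y))).
  rewrite GZ {1}GE mulHFDl LD LD LM LB -hBJ -!addrA; congr (_ + _).
  by rewrite -!LD hpD hpN mulHFDr mulHFNr addrCA.
rewrite AJ mulHFDl -LM LGZ -addrA opprD addrA subrr add0r frobN.
apply: le_trans (ler_frobD _ _) _; apply: lerD.
  apply: le_trans (frobL _ _) _; apply: ler_wpM2l => //.
  apply: le_trans (ler_frobD _ _) _; rewrite mulrDl mul1r; apply: lerD.
    exact: le_trans (frob_proj _ _) (frob_subrows _ _).
  apply: le_trans (frob_coproj _ _) _.
  apply: le_trans (frob_mulHF _ hW) _; rewrite mulrC.
  exact: ler_wpM2l frob_submatrix.
have hZ := opbound_coefficients; rewrite -/Z in hZ.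
apply: le_trans (frob_mulHF _ hZ) _; apply: ler_wpM2r; first by case: hZ.
apply: le_trans (ler_frobB _ _) _; rewrite mulrDl mul1r; apply: lerD.
  exact: frob_subcols.
apply: le_trans (frobL _ _) _.
exact: ler_wpM2l frob_submatrix.
Qed.

End Bounds.

End CrossApproximation.

(** * Transposition, final arithmetic and assembly *)

Lemma trmx_submatrix (T : Type) m n (A : 'M[T]_(m, n)) I J :
  (submatrix A I J)^T = submatrix A^T J I.
Proof. by apply/matrixP => i j; rewrite !mxE. Qed.

Lemma trmx_subcols (T : Type) m n (A : 'M[T]_(m, n)) J :
  (subcols A J)^T = subrows A^T J.
Proof. by apply/matrixP => i j; rewrite !mxE. Qed.

Lemma cross_bound_arith (R : realType) (a c x y g h e eta xi : R) :
  0 <= a -> 0 <= c -> 0 <= x -> 0 <= y -> 0 <= g -> 0 <= h -> 0 <= e ->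
  eta = a + c + 3 * a * c -> xi = y + x + 3 * y * x ->
  a * ((1 + c) * e) + (1 + a) * e * (c + g * ((1 + c) * e))
    + (1 + x) * e * (c + g * ((1 + c) * e)) <=
  eta * (2 + xi) * e + (1 + eta) * (2 + xi) * (g + h) * e ^+ 2.
Proof.
move=> a0 c0 x0 y0 g0 h0 e0 etaE xiE.
(* Linear arithmetic treats products as atoms, so their signs are supplied. *)
have ac0 : 0 <= a * c by exact: mulr_ge0.
have xy0 : 0 <= y * x by exact: mulr_ge0.
have le1 : a * (1 + c) + (1 + a) * c + (1 + x) * c <= eta * (2 + xi).
  have : (1 + x) * c <= (1 + xi) * eta.
    by apply: ler_pM; lra.
  lra.
have le2 : (1 + a) * (1 + c) + (1 + x) * (1 + c) <= (1 + eta) * (2 + xi).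
  have : (1 + x) * (1 + c) <= (1 + xi) * (1 + eta).
    by apply: ler_pM; lra.
  lra.
have eta0 : 0 <= eta by lra.
have xi0 : 0 <= xi by lra.
have ge0 : 0 <= g * e ^+ 2 by rewrite mulr_ge0 ?sqr_ge0.
(* The left side contains [g] alone; the summand with [h] is nonnegative and only enlarges the right
   side. *)
have he0 : 0 <= (1 + eta) * (2 + xi) * (h * e ^+ 2).
  by apply: mulr_ge0; [apply: mulr_ge0; lra | rewrite mulr_ge0 ?sqr_ge0].
have := lerD (ler_wpM2r e0 le1) (ler_wpM2r ge0 le2).
rewrite (mulrDr _ g h) (mulrDl _ _ (e ^+ 2)) -!(mulrA _ _ (e ^+ 2)).
move=> le12; rewrite addrA; apply: le_trans (_ : _ <= _ + _) _; last first.
  by apply: lerD he0; exact: le12.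
rewrite addr0 le_eqVlt; apply/orP; left; apply/eqP; ring.
Qed.

Theorem theorem7p11 (R : realType) (k : RorC_kind) (H : hilbertType R k)
    (m n : nat) (A B E : 'M[H]_(m, n)) (I : {set 'I_m}) (J : {set 'I_n})
    (r s : nat)
    (U : 'M[H]_(m, r)) (Sigma : 'rV[RorC R k]_r) (V : 'M[RorC R k]_(n, r))
    (P : 'M[H]_(n, s)) (Lambda : 'rV[RorC R k]_s) (Q : 'M[RorC R k]_(m, s))
    (hA : A = B + E) (hB : B <> 0)
    (hsvd : is_svd B U Sigma V) (hsvdT : is_svd B^T P Lambda Q)
    (hrk : rankT (submatrix B I J) = rankT B) :
  let G := submatrix A I J in
  let eta_r := hopnorm (hpinv (subrows U I)) in
  let eta_c := eopnorm (epinv (ctmx (subrows V J))) in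
  let xi_r := eopnorm (epinv (subrows Q I)) in
  let xi_c := hopnorm (hpinv (subrows P J)) in
  let eta := eta_r + eta_c + 3 * eta_r * eta_c in
  let xi := xi_c + xi_r + 3 * xi_c * xi_r in
  hnorm (B - cross_approx A I J) <=
    eta * (2 + xi) * hnorm E
    + (1 + eta) * (2 + xi) * (hopnorm (hpinv G) + hopnorm (hpinv G^T))
      * hnorm E ^+ 2.
Proof.
lazy zeta.
have [rkT rk] : hrank (submatrix B I J)^T = hrank B^T /\
    hrank (submatrix B I J) = hrank B by case: hrk.
rewrite trmx_submatrix in rkT.
have [U_inj [Y VY]] := svd_submatrix hsvd rk.
have [_ [Y' QY']] := svd_submatrix hsvdT rkT.
have [K VK hK] := epinv_surjective VY.
have [K' QK' hK'] := epinv_injective QY'.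
have [W [hBI hBJ hW]] := svd_row_factor I hsvd VK hK.
(* The same construction for the transposes, with [I] and [J] exchanged; [W'] has the bound
   [xi_r]. *)
have [W' [hBI' _ hW']] := svd_row_factor J hsvdT QK' hK'.
have hAT : A^T = B^T + E^T by rewrite hA raddfD.
have [_ [UU _] _ _ hB'] := hsvd.
rewrite columnwise_hadj in UU; rewrite mulHFA in hB'.
have col_le := frob_column_cross hA hW hBI hB' hBJ UU U_inj.
have row_le := frob_coproj_subrows hAT hW' hBI'.
have Z_le := opbound_coefficients hA hW hBI.
rewrite frob_tr in row_le.
set Z := hp _ _ in col_le Z_le.
set D := subrows A^T J - _ in row_le.
(* The transpose of [C - X G] is [C^T - G^T (G^T)^+ C^T], the projection error [D] of the transposed
   problem. *)
have -> : B - cross_approx A I J =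
    (B - mulHF (subcols A J) Z) + mulHF D^T Z.
  rewrite -addrA; congr (_ + _); rewrite -mulHFNl -mulHFDl /cross_approx.
  rewrite -mulHFNl; congr mulHF; apply: trmx_inj.
  rewrite !raddfD !raddfN /= mulFH_tr !trmxK.
  rewrite trmx_subcols trmx_submatrix /D.
  by rewrite addrA addNr add0r.
rewrite !(_ : forall p q (N : 'M[H]_(p, q)), hnorm N = frob N) //.
apply: le_trans (ler_frobD _ _) _.
apply: le_trans (lerD col_le (frob_mulHF _ Z_le)) _.
rewrite frob_tr.
apply: le_trans (lerD (lexx _) (ler_wpM2r _ row_le)) _.
  by case: Z_le.
(* The value of [y] enters only through the formula for [xi], so it is given explicitly. *)
apply: (cross_bound_arith (y := hopnorm (hpinv (subrows P J))));
  rewrite ?frob_ge0 //.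
all: apply: opnorm_ge0 => ?; exact: sqrtr_ge0.
Qed.
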